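(* Let $K$ be a field of characteristic different from $2$ and let $F_{p,q}(\mathfrak B_{\rm sup})$ be the free bicommutative superalgebra over $K$ on $p$ even and $q$ odd free generators, with a fixed well-ordering $\preceq$ of its monomials which is compatible with the multiplication. Then: (i) Any two-sided ideal $I$ of $F_{p,q}(\mathfrak B_{\rm sup})$ has a finite Gröbner-Shirshov basis $\text{Gröbner}(I)$. (ii) The ideal $I$ is generated by $\text{Gröbner}(I)$. (iii) The factor superalgebra $F_{p,q}(\mathfrak B_{\rm sup})/I$ has a vector space basis consisting of (the images of) all monomials which are not divisible by any leading monomial of the polynomials in $\text{Gröbner}(I)$.
   Context: Algebras are not assumed associative or unital. A superalgebra is an algebra $A=A_0\oplus A_1$ with $A_iA_j\subseteq A_{i+j\,(\mathrm{mod}\,2)}$; for $a\in A_i$ write $\overline a=i$. A superalgebra is bicommutative if for all homogeneous elements $x_1(x_2x_3)=(-1)^{\overline{x_1}\,\overline{x_2}}x_2(x_1x_3)$ and $(x_1x_2)x_3=(-1)^{\overline{x_2}\,\overline{x_3}}(x_1x_3)x_2$. Put $X_{p,q}=Y_p\cup Z_q$, $Y_p=\{y_1,\dots,y_p\}$ (even), $Z_q=\{z_1,\dots,z_q\}$ (odd). The algebra $F_{p,q}(\mathfrak B_{\rm sup})$, freely generated by $X_{p,q}$, is identified (via the isomorphism which is the identity on $X_{p,q}$) with the superalgebra $G_{\rm sup}(X_{p,q})=KX_{p,q}\oplus(\omega\otimes_K\omega)$, where $\omega$ is the augmentation ideal of the free unital associative super-commutative superalgebra on $X_{p,q}$ (relations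 $yx=xy$, $x\in X_{p,q}$, $y\in Y_p$, and $z_iz_j=-z_jz_i$), and the multiplication is $x_i\circ x_j=x_i\otimes x_j$, $x\circ(u\otimes v)=(xu)\otimes v$, $(u\otimes v)\circ x=u\otimes(vx)$, $(u_1\otimes v_1)\circ(u_2\otimes v_2)=(-1)^{\overline{v_1}(\overline{u_2}+\overline{v_2})}(u_1u_2)\otimes(v_2v_1)$ for $x,x_i,x_j\in X_{p,q}$ and homogeneous $u,v,u_i,v_i\in\omega$. Monomials: let $[X_{p,q}]$ be the commutative semigroup with zero of nonconstant monomials in $X_{p,q}$ with relations $z_j^2=0$, $j=1,\dots,q$. The monomials are the nonzero elements of $X_{p,q}\cup[X_{p,q}]\otimes[X_{p,q}]$; they form (up to signs) a basis of $G_{\rm sup}(X_{p,q})$. They multiply, up to sign, as in $G_{\rm sup}(X_{p,q})$: $x_i\circ x_j=x_i\otimes x_j$, $x_i\circ(u\otimes v)=x_iu\otimes v$, $(u\otimes v)\circ x_i=u\otimes vx_i$, $(u_1\otimes v_1)\circ(u_2\otimes v_2)=(u_1u_2)\otimes(v_1v_2)$. A well-ordering $\preceq$ of the monomials is compatible with the multiplication if, for monomials $u\prec v$ and $x_i\in X_{p,q}$: $x_i\circ u\ne0\ne x_i\circ v$ implies $x_i\circ u\prec x_i\circ v$, and $u\circ x_i\neq0\neq v\circ x_i$ implies $u\circ x_i\prec v\circ x_i$. For $f\neq0$, $\mathrm{lead}(f)$ is the largest monomial (with respect to $\preceq$) occurring in $f$ with nonzero coefficient. A monomial $w$ is divisible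 by a monomial $w'$ if $w$ can be obtained (up to sign) from $w'$ by consecutive (possibly no) multiplications from both sides by free generators from $X_{p,q}$. A subset $\text{Gröbner}(I)$ of a two-sided ideal $I$ is a Gröbner-Shirshov basis of $I$ if for every $0\ne f\in I$ there is a nonzero $f_i\in\text{Gröbner}(I)$ such that $\mathrm{lead}(f_i)$ divides $\mathrm{lead}(f)$. *)

(* Defs.v *)
From HB Require Import structures.
From mathcomp Require Import all_boot all_order all_algebra finmap.
From mathcomp Require Import boolp classical_sets cardinality wochoice.
From mathcomp Require Import mpoly monalg.

Set Implicit Arguments.
Unset Strict Implicit.
Unset Printing Implicit Defensive.

Import GRing.Theory.

Local Open Scope ring_scope.
Local Open Scope quotient_scope.

Section Monomials.
Variables p q : nat.

Definition generator : Type := ('I_p + 'I_q)%type.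
HB.instance Definition _ := Choice.on generator.

(* The basis monomial y^m z_S of the free unital associative super-commutative *)
(* superalgebra is (m, S), where z_S is the product of the z_j, j \in S, taken *)
(* in increasing order of j.                                                   *)
Definition supermon : Type := (multinom p * {set 'I_q})%type.
HB.instance Definition _ := Choice.on supermon.

Definition supermon_one : supermon := (0%MM, finset.set0).

Definition supermon_mul (u v : supermon) : supermon :=
  ((u.1 + v.1)%MM, u.2 :|: v.2).

Definition omega_mon : Type := {u : supermon | u != supermon_one}.
HB.instance Definition _ := Choice.on omega_mon.
HB.instance Definition _ := SubType.on omega_mon.

Definition omega_parity (u : omega_mon) : nat := #|(val u).2|.

Lemma supermon_mul_neq1 (u v : omega_mon) :
  supermon_mul (val u) (val v) != supermon_one.
Proof.
apply: contra (valP u); case: (val u) (val v) => [m S] [n T].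
rewrite /supermon_mul /supermon_one !xpair_eqE mnmD_eq0.
by rewrite finset.setU_eq0 => /andP[/andP[-> _] /andP[-> _]].
Qed.

(* None is the zero of the semigroup. *)
Definition omega_mul (u v : omega_mon) : option omega_mon :=
  if [disjoint (val u).2 & (val v).2]
  then Some (Sub (supermon_mul (val u) (val v)) (supermon_mul_neq1 u v))
  else None.

(* z_S z_T = (-1)^k z_(S :|: T) for S, T disjoint, where k is the number of    *)
(* pairs (i, j) in S x T with j < i.                                           *)
Definition omega_sign (u v : omega_mon) : nat :=
  \sum_(i in (val u).2) #|[set j in (val v).2 | (j < i)%N]|.

Definition gen_supermon (x : generator) : supermon :=
  match x with
  | inl i => (U_(i)%MM, finset.set0)
  | inr j => (0%MM, [set j])
  end.

Lemma gen_supermon_neq1 (x : generator) : gen_supermon x != supermon_one.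
Proof.
case: x => [i|j]; rewrite /gen_supermon /supermon_one xpair_eqE ?mnm1_eq0 //.
by rewrite -cards_eq0 cards1 andbF.
Qed.

Definition gen_omega (x : generator) : omega_mon :=
  Sub (gen_supermon x) (gen_supermon_neq1 x).

(* inl x is the generator x, and inr (u, v) is u (x) v. *)
Definition monomial : Type := (generator + omega_mon * omega_mon)%type.
HB.instance Definition _ := Choice.on monomial.

Definition monomial_mul (a b : monomial) : option monomial :=
  match a, b with
  | inl x, inl y => Some (inr (gen_omega x, gen_omega y))
  | inl x, inr (u, v) =>
      omap (fun xu => inr (xu, v)) (omega_mul (gen_omega x) u)
  | inr (u, v), inl x =>
      omap (fun vx => inr (u, vx)) (omega_mul v (gen_omega x))
  | inr (u1, v1), inr (u2, v2) =>
      match omega_mul u1 u2, omega_mul v2 v1 with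
      | Some u, Some v => Some (inr (u, v))
      | _, _ => None
      end
  end.

Definition monomial_sign (a b : monomial) : nat :=
  match a, b with
  | inl _, inl _ => 0
  | inl x, inr (u, _) => omega_sign (gen_omega x) u
  | inr (_, v), inl x => omega_sign v (gen_omega x)
  | inr (u1, v1), inr (u2, v2) =>
      omega_parity v1 * (omega_parity u2 + omega_parity v2)
      + omega_sign u1 u2 + omega_sign v2 v1
  end.

Inductive divides (w' : monomial) : monomial -> Prop :=
  | divides_refl : divides w' w'
  | divides_left (x : generator) (w xw : monomial) :
      divides w' w -> monomial_mul (inl x) w = Some xw -> divides w' xw
  | divides_right (x : generator) (w wx : monomial) :
      divides w' w -> monomial_mul w (inl x) = Some wx -> divides w' wx.

Section Order.
Variable le : rel monomial.

Definition strict (u v : monomial) : Prop := u <> v /\ le u v.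

Definition mul_compatible : Prop :=
  forall (x : generator) (u v : monomial), strict u v ->
    (forall xu xv, monomial_mul (inl x) u = Some xu ->
                   monomial_mul (inl x) v = Some xv -> strict xu xv)
    /\
    (forall ux vx, monomial_mul u (inl x) = Some ux ->
                   monomial_mul v (inl x) = Some vx -> strict ux vx).

End Order.
End Monomials.

Section Algebra.
Variables (K : fieldType) (p q : nat).

(* The underlying space of G_sup(X_{p,q}), the free bicommutative superalgebra *)
(* on p even and q odd generators: formal linear combinations of monomials.    *)
Definition gsup : Type := {malg K[monomial p q]}.
HB.instance Definition _ := GRing.Lmodule.on gsup.

Definition basis_mul (a b : monomial p q) : gsup :=
  if monomial_mul a b is Some c then (-1) ^+ monomial_sign a b *: << c >>
  else 0.

Definition gmul (f g : gsup) : gsup :=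
  \sum_(a <- msupp f) \sum_(b <- msupp g) (mcoeff a f * mcoeff b g) *: basis_mul a b.

Definition two_sided_ideal (I : set gsup) : Prop :=
  [/\ I 0,
      (forall (c : K) (f g : gsup), I f -> I g -> I (c *: f + g))
    & (forall f g : gsup, I f -> I (gmul f g) /\ I (gmul g f))].

Definition generated_ideal (B : set gsup) : set gsup :=
  smallest two_sided_ideal B.

Section GroebnerShirshov.
Variable le : rel (monomial p q).

Definition is_lead (f : gsup) (w : monomial p q) : Prop :=
  maximum_of le [pred u | u \in msupp f] w.

Definition groebner_shirshov (I B : set gsup) : Prop :=
  (B `<=` I)%classic /\
  forall f : gsup, I f -> f <> 0 ->
    exists g : gsup, [/\ B g, g <> 0 &
      exists w' w, [/\ is_lead g w', is_lead f w & divides w' w]].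

Definition normal_monomials (B : set gsup) : set (monomial p q) :=
  [set w | ~ exists g w', [/\ B g, g <> 0, is_lead g w' & divides w' w]]%classic.

End GroebnerShirshov.

Section Factor.
Variables (I : set gsup) (idI : two_sided_ideal I).

Local Notation ideal_pred := (fun f : gsup => `[< I f >]).

Lemma ideal_zmod_closed : zmod_closed ideal_pred.
Proof.
case: idI => I0 IL _; split=> [|f g /asboolP If /asboolP Ig]; apply/asboolP=> //.
by rewrite -[f - g]addrC -scaleN1r; apply: IL.
Qed.

Definition ideal_zmod : zmodClosed gsup :=
  HB.pack ideal_pred (GRing.isZmodClosed.Build gsup ideal_pred ideal_zmod_closed).

Local Notation J := ideal_zmod.

Lemma ideal_predZ c f : f \in J -> c *: f \in J.
Proof.
case: idI => I0 IL _ /asboolP If; apply/asboolP.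
by rewrite -[c *: f]addr0; apply: IL.
Qed.

Definition factor : Type := Quotient.quot J.
HB.instance Definition _ := GRing.Zmodule.on factor.
HB.instance Definition _ := EqQuotient.on factor.

Definition factor_scale (c : K) (x : factor) : factor :=
  \pi_factor (c *: repr x).

Lemma pi_factorP (f g : gsup) :
  \pi_factor f = \pi_factor g <-> f - g \in J.
Proof.
by rewrite (Quotient.idealrBE J); split=> [/eqP|/eqP].
Qed.

Lemma pi_factorD (f g : gsup) :
  \pi_factor (f + g) = \pi_factor f + \pi_factor g.
Proof. exact: (raddfD \pi_(Quotient.quot J)). Qed.

Lemma pi_factorZ c (f : gsup) :
  \pi_factor (c *: f) = factor_scale c (\pi_factor f).
Proof.
apply/pi_factorP; rewrite -scalerBr; apply: ideal_predZ.
by apply/pi_factorP; rewrite reprK.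
Qed.

Lemma factor_scaleA a b x :
  factor_scale a (factor_scale b x) = factor_scale (a * b) x.
Proof. by rewrite -[x]reprK -!pi_factorZ scalerA reprK. Qed.

Lemma factor_scale1 : left_id 1 factor_scale.
Proof. by move=> x; rewrite -[x]reprK -pi_factorZ scale1r. Qed.

Lemma factor_scaleDr : right_distributive factor_scale +%R.
Proof.
move=> c x y; rewrite -[x]reprK -[y]reprK -pi_factorD -!pi_factorZ.
by rewrite scalerDr pi_factorD.
Qed.

Lemma factor_scaleDl x : {morph factor_scale^~ x : a b / a + b}.
Proof.
by move=> a b /=; rewrite -[x]reprK -!pi_factorZ scalerDl pi_factorD.
Qed.

HB.instance Definition _ := GRing.Zmodule_isLmodule.Build K factor
  factor_scaleA factor_scale1 factor_scaleDr factor_scaleDl.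

Definition factor_proj (f : gsup) : factor := \pi_factor f.

End Factor.
End Algebra.

(* The family (b t), t in B, is a basis of V; in particular t |-> b t is       *)
(* injective on B.                                                             *)
Definition family_basis (K : fieldType) (V : lmodType K) (T : eqType)
    (B : set T) (b : T -> V) : Prop :=
  (forall (s : seq T) (c : T -> K), uniq s -> (forall t, t \in s -> B t) ->
     \sum_(t <- s) c t *: b t = 0 -> forall t, t \in s -> c t = 0)
  /\
  (forall v : V, exists (s : seq T) (c : T -> K),
     (forall t, t \in s -> B t) /\ v = \sum_(t <- s) c t *: b t).

(* Main.v *)
Require Import Defs.
From mathcomp Require Import all_boot all_order all_algebra finmap.
From mathcomp Require Import boolp classical_sets cardinality wochoice.
From mathcomp Require Import mpoly monalg.

(** The theorem rests on two facts.

    Divisibility of monomials is a well-quasi-order ([divides_finitely_based]).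
    Up to the finitely many choices of a generator, or of the odd parts S and T
    in y^m z_S (x) y^n z_T, a monomial is a pair of exponent vectors (m, n).
    Multiplying by an even generator on the left increases m, and on the right
    increases n, with no possibility of getting zero; so Dickson's lemma for
    the vectors (m, n) provides, in any set of monomials, finitely many elements
    that divide all the others.

    Multiplication by a generator multiplies leading monomials
    ([is_lead_gmul_genl], [is_lead_gmul_genr]).  It sends each monomial to plus
    or minus a monomial or to zero, and compatibility of the order says that it
    is strictly increasing where it is nonzero; hence no cancellation can reach
    the image of the leading term when this image is nonzero.  Therefore, if
    lead(g) divides w, the ideal of g contains an element with leading monomial
    w ([ideal_lead_divides]).

    The second fact gives a division algorithm ([division]): modulo an ideal
    containing B, every f is congruent to a combination of B-normal monomials,
    by well-founded induction on lead(f).  The definition of a basis B of I says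
    that a nonzero element of I has a leading monomial that is not normal, so 0
    is the only element of I supported on normal monomials
    ([ideal_normal_eq0]).

    (i) Choose an element of I for each member of a finite set of leading
    monomials dividing all leading monomials of I.  (ii) Divide f in I modulo
    the ideal generated by B: the remainder is in I and normal, hence zero.
    (iii) Division modulo I shows that the normal monomials span the factor, and
    a relation among their images is a normal element of I, hence trivial. *)

Set Implicit Arguments.
Unset Strict Implicit.
Unset Printing Implicit Defensive.

Import GRing.Theory.

Local Open Scope ring_scope.

Local Notation "f @_ w" := (monalg.mcoeff w f) : ring_scope.

(** * Well-orderings *)

Section WellOrder.
Variables (T : eqType) (le : rel T).
Hypothesis wo_le : well_order le.

Let wo_chainT : wo_chain le T.
Proof. by move=> A _; apply: wo_le. Qed.

Lemma well_order_total : total le.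
Proof. by move=> x y; apply: (wo_chainW wo_chainT). Qed.

Lemma well_order_refl : reflexive le.
Proof. by move=> x; apply: (wo_chain_reflexive wo_chainT). Qed.

Lemma well_order_anti : antisymmetric le.
Proof. by move=> x y; apply: (wo_chain_antisymmetric wo_chainT). Qed.

(** Three elements are compared through the minimum of the set they form: it
    must be one of them, and in each case it yields the inequality. *)
Lemma well_order_trans : transitive le.
Proof.
move=> y x z lexy leyz.
have [|m [[mA lbm] _]] := wo_le (A := [pred t | t \in [:: x; y; z]]).
  by exists x; rewrite !inE eqxx.
have [mx my mz] : [/\ le m x, le m y & le m z].
  by split; apply: lbm; rewrite !inE eqxx ?orbT.
move: mA; rewrite !inE => /or3P[] /eqP em; first by rewrite -em.
- by rewrite (@well_order_anti x y) // lexy -em mx.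
- by rewrite -(@well_order_anti y z) // leyz -em my.
Qed.

Lemma well_order_ind (P : T -> Prop) :
  (forall x, (forall y, y <> x /\ le y x -> P y) -> P x) -> forall x, P x.
Proof.
move=> step x; apply: contrapT => nPx.
have [|m [[/asboolP nPm lbm] _]] := wo_le (A := [pred t | `[< ~ P t >]]).
  by exists x; apply/asboolP.
apply: nPm; apply: step => y [neq_ym leym].
apply: contrapT => nPy; apply: neq_ym; apply: well_order_anti.
by rewrite leym; apply: lbm; apply/asboolP.
Qed.

Lemma well_order_max (s : seq T) : s != [::] ->
  exists2 m, m \in s & {in s, forall x, le x m}.
Proof.
elim: s => // x s IHs _; case: (eqVneq s [::]) => [->|/IHs[m ms ubm]].
  by exists x => [|y]; rewrite !inE // => /eqP->; apply: well_order_refl.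
case/orP: (well_order_total x m) => [lexm|lemx].
  by exists m => [|y]; rewrite !inE ?ms ?orbT // => /predU1P[->|/ubm].
exists x => [|y]; rewrite !inE ?eqxx // => /predU1P[->|/ubm leym].
  exact: well_order_refl.
exact: well_order_trans lemx.
Qed.

Lemma well_order_lt_le_trans y x z : x <> y /\ le x y -> le y z -> x <> z /\ le x z.
Proof.
move=> [neq_xy lexy] leyz; split; last exact: well_order_trans leyz.
by move=> exz; apply: neq_xy; apply: well_order_anti; rewrite lexy exz.
Qed.

End WellOrder.

(** * Dickson's lemma *)

Section FinitelyBased.
Variable T : eqType.
Implicit Types (r : T -> T -> Prop) (A : set T).

(** For a transitive [r] such as divisibility, every set being finitely based
    amounts to [r] being a well-quasi-order; this form is the one that is used,
    and it is proved by induction without infinite sequences. *)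
Definition finitely_based r A :=
  exists s : seq T, {in s, forall b, A b} /\
    forall a, A a -> exists2 b, b \in s & r b a.

Lemma finitely_based_imply r r' A :
  (forall b a, A b -> A a -> r b a -> r' b a) ->
  finitely_based r A -> finitely_based r' A.
Proof.
move=> rr' [s [sA sP]]; exists s; split=> // a Aa.
by have [b bs rba] := sP a Aa; exists b => //; apply: rr' => //; apply: sA.
Qed.

Lemma finitely_based_slices (J : eqType) (c : T -> J) (l : seq J) r A :
  (forall j, finitely_based r [set a | A a /\ c a = j]%classic) ->
  finitely_based r [set a | A a /\ c a \in l]%classic.
Proof.
move=> slice; elim: l => [|j l [s [sA sP]]].
  by exists [::]; split=> // a [].
have [t [tA tP]] := slice j; exists (t ++ s); split.
  move=> b; rewrite mem_cat => /orP[/tA[Ab <-]|/sA[Ab cb]].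
    by split=> //; apply: mem_head.
  by split=> //; rewrite inE cb orbT.
move=> a [Aa]; rewrite inE => /predU1P[ca|ca].
  by have [//|b bt rba] := tP a; exists b => //; rewrite mem_cat bt.
by have [//|b bs rba] := sP a; exists b => //; rewrite mem_cat bs orbT.
Qed.

(** Take a finite basis [s] of [A] for the first [k] coordinates, and let [N]
    bound the last coordinate on [s].  An element of [A] whose last coordinate is
    at least [N] is above an element of [s]; the others lie in one of the [N]
    slices where the last coordinate is constant, which is thus harmless.
    The family [e] is arbitrary, rather than a projection of a type of
    vectors, so that the induction hypothesis applies to every slice of [A]. *)
Lemma dickson (k : nat) (e : T -> nat -> nat) A :
  finitely_based (fun b a => forall i, (i < k)%N -> (e b i <= e a i)%N) A.
Proof.
elim: k A => [|k IHk] A.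
  have [[a Aa]|noA] := pselect (exists a, A a).
    by exists [:: a]; split=> [b|b _]; [rewrite inE => /eqP->|exists a; rewrite ?inE].
  by exists [::]; split=> // a Aa; case: noA; exists a.
have [s [sA sP]] := IHk A.
pose N := (\max_(b <- s) e b k)%N.
have [|t [tA tP]] := @finitely_based_slices _ (e^~ k) (iota 0 N)
    (fun b a => forall i, (i < k.+1)%N -> (e b i <= e a i)%N) A.
  move=> n; apply: finitely_based_imply (IHk _) => b a [_ ebk] [_ eak] le_ba i.
  by rewrite ltnS leq_eqVlt => /predU1P[->|/le_ba//]; rewrite ebk eak.
exists (s ++ t); split=> [b|a Aa].
  by rewrite mem_cat => /orP[/sA|/tA[]].
have [ltaN|leNa] := ltnP (e a k) N.
  have [|b bt le_ba] := tP a; first by rewrite /= mem_iota ltaN.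
  by exists b => //; rewrite mem_cat bt orbT.
have [b bs le_ba] := sP a Aa; exists b; first by rewrite mem_cat bs.
move=> i; rewrite ltnS leq_eqVlt => /predU1P[->|/le_ba//].
apply: leq_trans leNa; exact: leq_bigmax_seq.
Qed.

End FinitelyBased.

(** * Divisibility of monomials *)

Section Divisibility.
Variables p q : nat.
Implicit Types (u v : omega_mon p q) (w : monomial p q) (n : multinom p).

Lemma divides_trans w2 w1 w3 : divides w1 w2 -> divides w2 w3 -> divides w1 w3.
Proof.
move=> d12; elim=> // x w xw _ d1w; [exact: divides_left|exact: divides_right].
Qed.

Lemma omega_shift_neq1 n u : ((n + (val u).1)%MM, (val u).2) != supermon_one p q.
Proof.
apply: contra (valP u); case: (val u) => m S.
by rewrite /supermon_one !xpair_eqE mnmD_eq0 => /andP[/andP[_ ->] ->].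
Qed.

(** Multiplication by the even monomial y^n, which is total: only odd
    generators can produce zero. *)
Definition omega_shift n u : omega_mon p q :=
  Sub ((n + (val u).1)%MM, (val u).2) (omega_shift_neq1 n u).

Lemma omega_shift0 u : omega_shift 0%MM u = u.
Proof. by apply: val_inj; rewrite /= add0m; case: (val u). Qed.

Lemma omega_shiftD n1 n2 u :
  omega_shift (n1 + n2)%MM u = omega_shift n1 (omega_shift n2 u).
Proof. by apply: val_inj; rewrite /= addmA. Qed.

Lemma omega_mul_evenl (i : 'I_p) u :
  omega_mul (gen_omega (inl i : generator p q)) u = Some (omega_shift U_(i)%MM u).
Proof.
rewrite /omega_mul /= -setI_eq0 finset.set0I eqxx; congr Some.
by apply: val_inj; rewrite /= /supermon_mul /= finset.set0U.
Qed.

Lemma omega_mul_evenr (i : 'I_p) u :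
  omega_mul u (gen_omega (inl i : generator p q)) = Some (omega_shift U_(i)%MM u).
Proof.
rewrite /omega_mul /= -setI_eq0 finset.setI0 eqxx; congr Some.
by apply: val_inj; rewrite /= /supermon_mul /= finset.setU0 addmC.
Qed.

Lemma mnm_ind (P : multinom p -> Prop) :
  P 0%MM -> (forall i n, P n -> P (U_(i) + n)%MM) -> forall n, P n.
Proof.
move=> P0 PU n; rewrite (multinomUE_id n).
elim/big_rec: _ => // i m _ Pm; elim: (n i) => [|k IHk].
  by rewrite mulm0n add0m.
by rewrite mulmS -addmA; apply: PU.
Qed.

(** The left factor grows by multiplications from the left, and the right
    factor by multiplications from the right, independently. *)
Lemma divides_shift n1 n2 u v :
  divides (inr (u, v)) (inr (omega_shift n1 u, omega_shift n2 v)).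
Proof.
apply: (@divides_trans (inr (omega_shift n1 u, v))).
  elim/mnm_ind: n1 => [|i n IHn]; first by rewrite omega_shift0; apply: divides_refl.
  by apply: divides_left (inl i) _ _ IHn _; rewrite /= omega_mul_evenl omega_shiftD.
elim/mnm_ind: n2 => [|i n IHn]; first by rewrite omega_shift0; apply: divides_refl.
by apply: divides_right (inl i) _ _ IHn _; rewrite /= omega_mul_evenr omega_shiftD.
Qed.

Definition mon_label w : generator p q + {set 'I_q} * {set 'I_q} :=
  match w with
  | inl x => inl x
  | inr (u, v) => inr ((val u).2, (val v).2)
  end.

Definition mon_exponent w (i : 'I_p + 'I_p) : nat :=
  match w, i with
  | inl _, _ => 0
  | inr (u, _), inl i => (val u).1 i
  | inr (_, v), inr i => (val v).1 i
  end.

Lemma omega_le_shift u u' : (val u).2 = (val u').2 ->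
  (forall i, ((val u).1 i <= (val u').1 i)%N) ->
  u' = omega_shift ((val u').1 - (val u).1)%MM u.
Proof.
move=> eqS leuu'; apply: val_inj => /=.
by rewrite submK ?eqS; [apply: surjective_pairing|apply/mnm_lepP].
Qed.

(** Between monomials with the same odd parts, divisibility contains the
    componentwise order on exponents. *)
Lemma divides_exponent w w' : mon_label w = mon_label w' ->
  (forall i, (mon_exponent w i <= mon_exponent w' i)%N) -> divides w w'.
Proof.
case: w w' => [x|[u v]] [x'|[u' v']] //=; first by case=> -> _; apply: divides_refl.
move=> [eqS eqS'] le_ww'.
rewrite (omega_le_shift eqS (fun i => le_ww' (inl i))).
rewrite (omega_le_shift eqS' (fun i => le_ww' (inr i))).
exact: divides_shift.
Qed.

Lemma divides_finitely_based (A : set (monomial p q)) :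
  finitely_based (@divides p q) A.
Proof.
pose L := (('I_p + 'I_q) + {set 'I_q} * {set 'I_q})%type.
have [|s [sA sP]] := @finitely_based_slices _ _ (@mon_label : _ -> L)
    (enum {: L}) (@divides p q) A.
  (* The coordinates are numbered through the enumeration of 'I_p + 'I_p; the
     default 0 only concerns numbers that name no coordinate. *)
  move=> j; pose e w k := if insub k is Some i then
                            mon_exponent w (enum_val (i : 'I_#|{: 'I_p + 'I_p}|))
                          else 0%N.
  apply: finitely_based_imply (dickson #|{: 'I_p + 'I_p}| e _).
  move=> b a [_ lb] [_ la] le_ba.
  apply: divides_exponent => [|i]; first by rewrite lb la.
  have := le_ba (enum_rank i) (ltn_ord _).
  by rewrite /e valK enum_rankK.
exists s; split=> [b /sA[]//|a Aa].
by apply: sP; split=> //; apply: mem_enum.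
Qed.

End Divisibility.

(** * Leading monomials *)

Section BasisElement.
Variables (K : fieldType) (p q : nat).

Lemma mcoeff_mon (w u : monomial p q) : (<< w >> : gsup K p q)@_u = (w == u)%:R.
Proof. exact: mcoeffU. Qed.

Lemma msupp_mon (w : monomial p q) : msupp (<< w >> : gsup K p q) = [fset w]%fset.
Proof. by rewrite msuppU oner_eq0. Qed.

Lemma gsupE (f : gsup K p q) : f = \sum_(w <- msupp f) f@_w *: << w >>.
Proof.
rewrite {1}[f]monalgE; apply: eq_bigr => w _.
by apply/malgP => u; rewrite mcoeffZ mcoeff_mon mcoeffU mulr_natr.
Qed.

End BasisElement.

Section Leading.
Variables (K : fieldType) (p q : nat) (le : rel (monomial p q)).
Hypothesis wo_le : well_order le.
Implicit Types (f g h : gsup K p q) (u v w : monomial p q).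

Lemma is_lead_exists f : f != 0 -> exists w, is_lead le f w.
Proof.
move=> f0; have [|w wf ubw] := well_order_max wo_le (s := msupp f).
  apply: contra f0 => /eqP sf0; apply/eqP/malgP => w; rewrite mcoeff0.
  by apply: mcoeff_outdom; rewrite -[_ \in _]/(w \in (msupp f : seq _)) sf0.
by exists w.
Qed.

Lemma is_lead_coeff f w : is_lead le f w -> f@_w != 0.
Proof. by case=> wf _; rewrite mcoeff_neq0. Qed.

Lemma is_lead_neq0 f w : is_lead le f w -> f <> 0.
Proof. by move/is_lead_coeff=> fw f0; move: fw; rewrite f0 mcoeff0 eqxx. Qed.

(** The monomials produced are pairwise distinct, since [phi] is strictly
    increasing on its domain: the image of the leading monomial of [h] is the
    largest of them, and its coefficient is that of [h] up to sign.  Leaving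
    [phi] general covers multiplication by a generator on either side. *)
Lemma is_lead_increasing (phi : monomial p q -> option (monomial p q))
    (s : monomial p q -> nat) h w w' :
  (forall u v u' v', strict le u v -> phi u = Some u' -> phi v = Some v' ->
     strict le u' v') ->
  is_lead le h w -> phi w = Some w' ->
  is_lead le (\sum_(b <- msupp h) h@_b *:
     (if phi b is Some c then (-1) ^+ s b *: << c >> else 0)) w'.
Proof.
move=> phi_incr [wh ubw] phiw; set F := \sum_(b <- _) _.
have FE c : F@_c = \sum_(b <- msupp h)
    (if phi b == Some c then h@_b * (-1) ^+ s b else 0).
  rewrite /F raddf_sum /=; apply: eq_bigr => b _; rewrite mcoeffZ.
  case: (phi b) => [d|]; last by rewrite mcoeff0 mulr0.
  rewrite mcoeffZ mcoeff_mon (inj_eq Some_inj).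
  by case: eqP; rewrite ?mulr1 // mulr0 mulr0.
have phi_lt b c : b \in msupp h -> b != w -> phi b = Some c -> strict le c w'.
  move=> bh bw phib; apply: phi_incr phib phiw.
  by split; [exact/eqP|exact: ubw].
split.
  rewrite inE -mcoeff_neq0 FE (bigD1_seq w) //=; last exact: fset_uniq.
  (* No other monomial of h reaches w': its image is strictly smaller. *)
  rewrite phiw eqxx big_seq_cond big1 => [|b /andP[bh bw]].
    by rewrite addr0 mulf_neq0 ?mcoeff_neq0 // signr_eq0.
  case: eqP => // phib; have [] := phi_lt b w' bh bw phib.
  by [].
move=> c; rewrite inE -mcoeff_neq0 FE => Fc.
have [/hasP[b bh /eqP phib]|/hasPn nophi] :=
    boolP (has (fun b => phi b == Some c) (msupp h)); last first.
  move: Fc; rewrite big_seq big1 ?eqxx // => b /nophi.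
  by case: eqP.
have [ebw|bw] := eqVneq b w.
  by move: phib; rewrite ebw phiw => -[->]; apply: well_order_refl.
by have [] := phi_lt b c bh bw phib.
Qed.

Hypothesis compat_le : mul_compatible le.

Lemma gmul_genl (x : generator p q) h :
  gmul << inl x >> h = \sum_(b <- msupp h) h@_b *: basis_mul K (inl x) b.
Proof.
rewrite /gmul msupp_mon big_seq_fset1; apply: eq_bigr => b _.
by rewrite mcoeff_mon eqxx mul1r.
Qed.

Lemma gmul_genr (x : generator p q) h :
  gmul h << inl x >> = \sum_(a <- msupp h) h@_a *: basis_mul K a (inl x).
Proof.
rewrite /gmul; apply: eq_bigr => a _.
by rewrite msupp_mon big_seq_fset1 mcoeff_mon eqxx mulr1.
Qed.

Lemma is_lead_gmul_genl (x : generator p q) h w xw :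
  is_lead le h w -> monomial_mul (inl x) w = Some xw ->
  is_lead le (gmul << inl x >> h) xw.
Proof.
move=> lead_h xwE; rewrite gmul_genl.
apply: is_lead_increasing lead_h xwE => u v u' v' ltuv.
by have [+ _] := compat_le x ltuv; apply.
Qed.

Lemma is_lead_gmul_genr (x : generator p q) h w wx :
  is_lead le h w -> monomial_mul w (inl x) = Some wx ->
  is_lead le (gmul h << inl x >>) wx.
Proof.
move=> lead_h wxE; rewrite gmul_genr.
apply: (is_lead_increasing (phi := fun a => monomial_mul a (inl x))) lead_h wxE.
by move=> u v u' v' ltuv; have [_ +] := compat_le x ltuv; apply.
Qed.

(** Each multiplication by a generator witnessing the divisibility is applied
    to an element of the ideal, and carries its leading monomial along. *)
Lemma ideal_lead_divides (J : set (gsup K p q)) g w' w :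
  two_sided_ideal J -> J g -> is_lead le g w' -> divides w' w ->
  exists2 h, J h & is_lead le h w.
Proof.
move=> [_ _ Jmul] Jg lead_g; elim=> [|x v xv _ [h Jh lead_h] xvE
                             |x v vx _ [h Jh lead_h] vxE].
- by exists g.
- exists (gmul << inl x >> h); first by case: (Jmul h << inl x >> Jh).
  exact: is_lead_gmul_genl lead_h xvE.
- exists (gmul h << inl x >>); first by case: (Jmul h << inl x >> Jh).
  exact: is_lead_gmul_genr lead_h vxE.
Qed.

(** * Division with remainder *)

Definition normal_supported (B : set (gsup K p q)) f : Prop :=
  forall u, u \in msupp f -> normal_monomials le B u.

Lemma cancel_lead f k w : is_lead le f w -> is_lead le k w ->
  forall u, u \in msupp (f - (f@_w / k@_w) *: k) -> strict le u w.
Proof.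
move=> [_ ubf] lead_k u; have kw0 := is_lead_coeff lead_k.
have [_ ubk] := lead_k.
rewrite -mcoeff_neq0 mcoeffB mcoeffZ => ufk; split.
  by move=> euw; move: ufk; rewrite euw divfK // subrr eqxx.
have [/ubf//|uf] := boolP (u \in msupp f).
have [/ubk//|uk] := boolP (u \in msupp k).
move: ufk; rewrite (mcoeff_outdom uf) (mcoeff_outdom uk). by rewrite mulr0 subr0 eqxx.
Qed.

(** The leading term of [f] is removed by a multiple of [k] with the same
    leading monomial [w]: an element of the ideal if [w] is not normal, and [w]
    itself, which goes to the remainder, if [w] is normal.  What is left has a
    smaller leading monomial. *)
Lemma division (J B : set (gsup K p q)) : two_sided_ideal J -> (B `<=` J)%classic ->
  forall f, exists2 h, J h & normal_supported B (f - h).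
Proof.
move=> idJ BJ; have [J0 JL _] := idJ.
(* The zero element has no leading monomial, so it is left out of the induction. *)
suff div_lead w f : is_lead le f w -> exists2 h, J h & normal_supported B (f - h).
  move=> f; have [->|/is_lead_exists[w /div_lead//]] := eqVneq f 0.
  by exists 0 => // u; rewrite subr0 msupp0.
elim/(well_order_ind wo_le): w f => w IHw f lead_f.
have IHr r : (forall u, u \in msupp r -> strict le u w) ->
    exists2 h, J h & normal_supported B (r - h).
  move=> ltrw; have [->|/is_lead_exists[v lead_r]] := eqVneq r 0.
    by exists 0 => // u; rewrite subr0 msupp0.
  apply: (IHw v _ _ lead_r); apply: ltrw; by case: lead_r.
have [[g [w' [Bg _ lead_g dvd]]]|normal_w] :=
    pselect (exists g w', [/\ B g, g <> 0, is_lead le g w' & divides w' w]).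
  have [k Jk lead_k] := ideal_lead_divides idJ (BJ g Bg) lead_g dvd.
  have [h Jh norm_h] := IHr _ (cancel_lead lead_f lead_k).
  exists ((f@_w / k@_w) *: k + h); first exact: JL.
  by rewrite opprD addrA.
have lead_w : is_lead le (<< w >> : gsup K p q) w.
  split; first by rewrite inE msupp_mon inE.
  by move=> u; rewrite inE msupp_mon inE => /eqP->; apply: well_order_refl.
have [h Jh norm_h] := IHr _ (cancel_lead lead_f lead_w).
exists h => // u; have [->//|uw] := eqVneq u w.
rewrite -mcoeff_neq0 => ufh; apply: norm_h; move: ufh.
rewrite -mcoeff_neq0 !mcoeffB mcoeffZ !mcoeff_mon.
by rewrite [w == u]eq_sym (negPf uw) mulr0 subr0.
Qed.

(** Otherwise the leading monomial of [f] would be divisible by that of an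
    element of [B], while being normal. *)
Lemma ideal_normal_eq0 (I B : set (gsup K p q)) f :
  groebner_shirshov le I B -> I f -> normal_supported B f -> f = 0.
Proof.
move=> [_ gsB] If norm_f; apply: contrapT => f0.
have [g [Bg g0 [w' [w [lead_g lead_f dvd]]]]] := gsB f If f0.
by apply: (norm_f w); [case: lead_f|exists g, w'].
Qed.

End Leading.

(** * Gröbner–Shirshov bases *)

Section GroebnerShirshovBases.
Variables (K : fieldType) (p q : nat) (le : rel (monomial p q)).
Hypothesis wo_le : well_order le.
Implicit Types (I B : set (gsup K p q)).

Lemma finite_groebner_shirshov I :
  exists B, finite_set B /\ groebner_shirshov le I B.
Proof.
pose lead_of w (f : gsup K p q) := [/\ I f, f <> 0 & is_lead le f w].
have [s [sI sP]] := divides_finitely_based [set w | exists f, lead_of w f]%classic.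
pose pick w := xget 0 [set f | lead_of w f]%classic.
have pickP w : w \in s -> lead_of w (pick w).
  by move=> /sI[f fP]; apply: (xgetPex 0 (P := [set f | lead_of w f]%classic)); exists f.
exists (pick @` [set` s])%classic; split; first exact/finite_image/finite_seq.
split=> [_ [w ws <-]|f If f0]; first by have [] := pickP w ws.
have [w lead_f] := is_lead_exists wo_le (introN eqP f0).
have [|w' ws dvd] := sP w; first by exists f.
have [_ g0 lead_g] := pickP w' ws.
by exists (pick w'); split=> //; exists w', w.
Qed.

Lemma generated_ideal_two_sided B : two_sided_ideal (generated_ideal B).
Proof.
split=> [J [[J0 _ _] _]//|c f g If Ig J JP|f g If].
  by have [[_ JL _] _] := JP; apply: JL; [apply: If|apply: Ig].
by split=> J JP; have [[_ _ Jmul] _] := JP; case: (Jmul f g (If J JP)).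
Qed.

Hypothesis compat_le : mul_compatible le.

(** The division is made modulo the ideal generated by [B]; as this ideal lies
    in [I], the remainder of an element of [I] is still in [I]. *)
Lemma groebner_shirshov_generates I B : two_sided_ideal I ->
  groebner_shirshov le I B -> generated_ideal B = I.
Proof.
move=> idI gsB; have [_ IL _] := idI.
have genI : (generated_ideal B `<=` I)%classic by apply: smallest_sub; case: gsB.
apply/seteqP; split=> // f If.
have [h Bh norm_fh] := division wo_le compat_le (generated_ideal_two_sided B)
  (@sub_gen_smallest _ _ B) f.
suff /eqP : f - h = 0 by rewrite subr_eq0 => /eqP->.
apply: (ideal_normal_eq0 gsB) => //.
by rewrite addrC -scaleN1r; apply: IL => //; apply: genI.
Qed.

(** Independence is [ideal_normal_eq0] applied to a relation lifted to the free
    superalgebra; generation is [division] modulo [I] of a representative. *)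
Lemma normal_monomials_basis I (idI : two_sided_ideal I) B :
  groebner_shirshov le I B ->
  family_basis (normal_monomials le B)
    (fun w : monomial p q => factor_proj idI << w >>).
Proof.
move=> gsB; have [BI _] := gsB.
have proj0 : factor_proj idI 0 = 0.
  rewrite /factor_proj -[in LHS](scale0r (0 : gsup K p q)) pi_factorZ.
  exact: scale0r.
have projE (s : seq (monomial p q)) (c : monomial p q -> K) :
    \sum_(t <- s) c t *: factor_proj idI << t >> =
    factor_proj idI (\sum_(t <- s) c t *: << t >>).
  elim: s => [|t s IHs]; last first.
    by rewrite !big_cons IHs /factor_proj pi_factorD pi_factorZ.
  by rewrite !big_nil proj0.
split=> [s c uniq_s norm_s|x].
  set f : gsup K p q := \sum_(t <- s) c t *: << t >>.
  have fE t : f@_t = if t \in s then c t else 0.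
    rewrite /f raddf_sum /=; case: ifPn => ts.
      rewrite (bigD1_seq t) //= mcoeffZ mcoeff_mon eqxx mulr1.
      rewrite big1 ?addr0 // => u /negPf ut.
      by rewrite mcoeffZ mcoeff_mon ut mulr0.
    rewrite big_seq big1 // => u us; rewrite mcoeffZ mcoeff_mon.
    by case: eqP => [eut|_]; [rewrite -eut us in ts|rewrite mulr0].
  rewrite projE => f0 t ts.
  have If : I f.
    have := (pi_factorP idI f 0).1; rewrite subr0 => If.
    apply/asboolP; apply: If; rewrite -[LHS]/(factor_proj idI f) f0.
    exact: esym proj0.
  have <- : f@_t = c t by rewrite fE ts.
  rewrite (ideal_normal_eq0 gsB If) ?mcoeff0 // => u.
  rewrite -mcoeff_neq0 fE; case: ifPn => [us _|]; last by rewrite eqxx.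
  exact: norm_s.
rewrite -[x]reprK; set f : gsup K p q := repr x.
have [h Ih norm_fh] := division wo_le compat_le idI BI f.
exists (msupp (f - h)), (fun w => (f - h)@_w); split=> //.
rewrite projE -gsupE; apply/pi_factorP.
by rewrite opprB addrC subrK; apply/asboolP.
Qed.

End GroebnerShirshovBases.

Theorem theorem4p9 (K : fieldType) (charK : 2%N \notin [pchar K]) (p q : nat)
    (le : rel (monomial p q)) (wo_le : well_order le)
    (compat_le : mul_compatible le)
    (I : set (gsup K p q)) (idI : two_sided_ideal I) :
  [/\ exists B : set (gsup K p q), finite_set B /\ groebner_shirshov le I B,
      forall B : set (gsup K p q), groebner_shirshov le I B ->
        generated_ideal B = I
    & forall B : set (gsup K p q), groebner_shirshov le I B ->
        family_basis (normal_monomials le B)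
          (fun w : monomial p q => factor_proj idI << w >>)].
Proof.
split.
- exact: finite_groebner_shirshov.
- by move=> B; apply: groebner_shirshov_generates.
- by move=> B; apply: normal_monomials_basis.
Qed.
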